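(* Let $A,A'\in\mathbb{C}^{n\times n}$ with $\|A\|_F=\|A'\|_F=1$, let $v,v'\in\mathbb{C}^n$ be nonzero, and let $\lambda,\lambda'\in\mathbb{C}$ be such that $Av=\lambda v$. Suppose that $\mu(A,\lambda,v)\,\mathrm{dist}((A,\lambda,v),(A',\lambda',v'))\le\frac{\varepsilon}{12.5}$ for some $0<\varepsilon<0.37$. Then $\frac{1}{1+\varepsilon}\mu(A,\lambda,v)\le\mu(A',\lambda',v')\le(1+\varepsilon)\mu(A,\lambda,v)$.
   Context: $\|\cdot\|_F$ is the Frobenius norm. For $v\ne0$, $T_v=\{x\in\mathbb{C}^n:\langle x,v\rangle=0\}$, $P_{v^\perp}$ the orthogonal projection onto $T_v$, $A_{\lambda,v}=P_{v^\perp}(A-\lambda\mathrm{Id})|_{T_v}:T_v\to T_v$, and $\mu(A,\lambda,v)=\|A\|_F\|A_{\lambda,v}^{-1}\|$ (operator norm), with $\mu=\infty$ if $A_{\lambda,v}$ is not invertible. $d_{\mathbb{P}}(v,v')=\arccos(|\langle v,v'\rangle|/(\|v\|\|v'\|))$. For nonzero $A,A'$: $\mathrm{dist}((A,\lambda,v),(A',\lambda',v'))^2=\|\frac{A}{\|A\|_F}-\frac{A'}{\|A'\|_F}\|_F^2+|\frac{\lambda}{\|A\|_F}-\frac{\lambda'}{\|A'\|_F}|^2+d_{\mathbb{P}}(v,v')^2$. *)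

(* Defs.v *)
From mathcomp Require Import all_boot all_order all_algebra.
From mathcomp Require Import complex.
From mathcomp Require Import all_classical all_reals all_analysis.
Set Implicit Arguments. Unset Strict Implicit. Unset Printing Implicit Defensive.
Import Order.TTheory GRing.Theory Num.Theory.
Local Open Scope ring_scope.
Local Open Scope classical_set_scope.

Section Defs.
Variable R : realType.
Variable n : nat.
Local Notation C := R[i].

Definition cabs (z : C) : R := ComplexField.Normc.normc z.

Definition cinner (x v : 'cV[C]_n) : C := \sum_i x i 0 * conjc (v i 0).

Definition vnorm (x : 'cV[C]_n) : R := Num.sqrt (\sum_i cabs (x i 0) ^+ 2).

Definition frob (A : 'M[C]_n) : R :=
  Num.sqrt (\sum_i \sum_j cabs (A i j) ^+ 2).

Definition Tv (v : 'cV[C]_n) : set 'cV[C]_n := [set x | cinner x v = 0].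

Definition projT (v x : 'cV[C]_n) : 'cV[C]_n :=
  x - (cinner x v / cinner v v) *: v.

Definition Alv (A : 'M[C]_n) (l : C) (v x : 'cV[C]_n) : 'cV[C]_n :=
  projT v ((A - l%:M) *m x).

Definition Alv_invertible (A : 'M[C]_n) (l : C) (v : 'cV[C]_n) : Prop :=
  (forall x y, Tv v x -> Tv v y -> Alv A l v x = Alv A l v y -> x = y) /\
  (forall y, Tv v y -> exists2 x, Tv v x & Alv A l v x = y).

(* operator norm of A_{lambda,v}^{-1}: sup of ||A_{lambda,v}^{-1} y|| over
   y in T_v with ||y|| <= 1, where A_{lambda,v}^{-1} y is the unique x in T_v
   with A_{lambda,v} x = y (meaningful when Alv_invertible holds) *)
Definition inv_opnorm (A : 'M[C]_n) (l : C) (v : 'cV[C]_n) : \bar R :=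
  ereal_sup [set (vnorm x)%:E | x in
    [set x | Tv v x /\ exists y, [/\ Tv v y, vnorm y <= 1 & Alv A l v x = y]]].

Definition mu (A : 'M[C]_n) (l : C) (v : 'cV[C]_n) : \bar R :=
  if `[< Alv_invertible A l v >] then ((frob A)%:E * inv_opnorm A l v)%E
  else +oo%E.

Definition dP (v v' : 'cV[C]_n) : R :=
  acos (cabs (cinner v v') / (vnorm v * vnorm v')).

Definition dist3 (A : 'M[C]_n) (l : C) (v : 'cV[C]_n)
    (A' : 'M[C]_n) (l' : C) (v' : 'cV[C]_n) : R :=
  Num.sqrt (frob ((((frob A)^-1)%:C)%C *: A - (((frob A')^-1)%:C)%C *: A') ^+ 2
            + cabs (l * (((frob A)^-1)%:C)%C - l' * (((frob A')^-1)%:C)%C) ^+ 2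
            + dP v v' ^+ 2).

End Defs.

(* Main.v *)
(* Write (B,k,w) for the second triple. For x in T_w put y = P_v x; then x - y has norm at most sin(d_P(v,w)) |x|.
   If Av = lv, then A - l kills x - y, so that A_{l,v} y and B_{k,w} x differ by
   at most 6d |x|, where d bounds all three parts of the distance.  Conversely,
   for x in T_v and y = P_w x, the vectors B_{k,w} y and A_{l,v} x differ by at
   most (8+d)d |x|, because now B - k need not kill x - y.  As mu is the least
   m with |x| <= m |A_{l,v} x| on T_v, both inequalities follow from these
   comparisons and from mu d <= eps/12.5, together with mu >= 1/2 (when T_v is
   not zero), which makes d itself small. *)
Require Import Defs.
From mathcomp Require Import all_boot all_order all_algebra.
From mathcomp Require Import complex.
From mathcomp Require Import all_classical all_reals all_analysis.
From mathcomp Require Import ring lra.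
Import Order.TTheory GRing.Theory Num.Theory.
Import numFieldNormedType.Exports.
Local Open Scope ring_scope.

(** Mean value theorem with derivative [cos <= 1]. The geometry yields the sine of the angle between
    two lines, whereas [dist3] contains the angle itself. *)
Lemma sin_le_id (R : realType) (t : R) : 0 <= t -> sin t <= t.
Proof.
move=> t0.
have dsin x : x \in `]0, t[%R -> is_derive x 1 (sin : R -> R) (cos x).
  by move=> _; exact: is_derive_sin.
have csin : {within `[0, t]%classic, continuous (sin : R -> R)}%classic.
  by apply: continuous_subspaceT => x; exact: continuous_sin.
have [c _] := MVT_segment t0 dsin csin.
rewrite sin0 !subr0 => ->.
by rewrite ler_piMl// cos_le1.
Qed.

(** * Inner product, norm and orthogonal projections on complex column vectors *)

Section HermitianSpace.
Context {R : realType} {n : nat}.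
Local Notation C := R[i].
Implicit Types (x y v w : 'cV[C]_n) (z a : C).

Lemma cabs_ge0 z : 0 <= cabs z.
Proof. by case: z => a b; rewrite /cabs /= sqrtr_ge0. Qed.

Lemma cabsM z a : cabs (z * a) = cabs z * cabs a.
Proof. exact: ComplexField.Normc.normcM. Qed.

Lemma cabsD z a : cabs (z + a) <= cabs z + cabs a.
Proof. exact: le_normcD. Qed.

Lemma cabsN z : cabs (- z) = cabs z.
Proof. exact: normcN. Qed.

Lemma cabsV z : cabs z^-1 = (cabs z)^-1.
Proof. exact: ComplexField.Normc.normcV. Qed.

Lemma cabs_conjc z : cabs (conjc z) = cabs z.
Proof. by case: z => a b; rewrite /cabs /= sqrrN. Qed.

Lemma cabs_real (r : R) : 0 <= r -> cabs (r%:C)%C = r.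
Proof.
by move=> r0; rewrite /cabs /= expr0n /= addr0 sqrtr_sqr ger0_norm.
Qed.

Lemma cabs_sqr z : ((cabs z ^+ 2)%:C)%C = z * conjc z.
Proof.
case: z => a b; rewrite /cabs /= sqr_sqrtr ?addr_ge0 ?sqr_ge0//.
by apply/eqP; rewrite eq_complex /=; apply/andP; split; apply/eqP; ring.
Qed.

Lemma vnorm_ge0 x : 0 <= vnorm x.
Proof. exact: sqrtr_ge0. Qed.

Lemma vnorm_sqr x : vnorm x ^+ 2 = \sum_i cabs (x i 0) ^+ 2.
Proof. by rewrite sqr_sqrtr// sumr_ge0// => i _; exact: sqr_ge0. Qed.

Lemma cinner_self x : cinner x x = ((vnorm x ^+ 2)%:C)%C.
Proof.
rewrite vnorm_sqr rmorph_sum; apply: eq_bigr => i _.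
by rewrite /= cabs_sqr.
Qed.

Lemma cinnerDl x y v : cinner (x + y) v = cinner x v + cinner y v.
Proof. by rewrite -big_split; apply: eq_bigr => i _; rewrite mxE mulrDl. Qed.

Lemma cinnerZl a x v : cinner (a *: x) v = a * cinner x v.
Proof. by rewrite mulr_sumr; apply: eq_bigr => i _; rewrite mxE mulrA. Qed.

Lemma cinner_conj x y : conjc (cinner x y) = cinner y x.
Proof.
rewrite rmorph_sum; apply: eq_bigr => i _.
by rewrite rmorphM /= conjcK mulrC.
Qed.

Lemma cinnerDr v x y : cinner v (x + y) = cinner v x + cinner v y.
Proof. by rewrite -cinner_conj cinnerDl rmorphD /= !cinner_conj. Qed.

Lemma cinnerZr a v x : cinner v (a *: x) = conjc a * cinner v x.
Proof. by rewrite -cinner_conj cinnerZl rmorphM /= !cinner_conj. Qed.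

Lemma cinner0l v : cinner 0 v = 0.
Proof. by rewrite -(scale0r v) cinnerZl mul0r. Qed.

Lemma cinnerNl x v : cinner (- x) v = - cinner x v.
Proof. by rewrite -scaleN1r cinnerZl mulN1r. Qed.

Lemma cabs_cinnerC x y : cabs (cinner x y) = cabs (cinner y x).
Proof. by rewrite -cinner_conj cabs_conjc. Qed.

Lemma pythagoras x y : cinner x y = 0 ->
  vnorm (x + y) ^+ 2 = vnorm x ^+ 2 + vnorm y ^+ 2.
Proof.
move=> xy0; have yx0 : cinner y x = 0 by rewrite -cinner_conj xy0 conjc0.
apply: (@complexI R); rewrite rmorphD /= -!cinner_self.
by rewrite cinnerDl !cinnerDr xy0 yx0 addr0 add0r.
Qed.

Lemma vnorm_eq0 x : vnorm x = 0 -> x = 0.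
Proof.
move=> x0; have : \sum_i cabs (x i 0) ^+ 2 = 0.
  by rewrite -vnorm_sqr x0 expr0n.
move/psumr_eq0P => h; apply/colP => i; rewrite mxE.
apply: ComplexField.Normc.eq0_normc; apply/eqP.
by rewrite -(@sqrf_eq0 R); apply/eqP/h => // j _; exact: sqr_ge0.
Qed.

Lemma vnorm_gt0 v : v != 0 -> 0 < vnorm v.
Proof.
move=> v0; rewrite lt_def vnorm_ge0 andbT.
by apply: contraNneq v0 => /vnorm_eq0 ->.
Qed.

Lemma vnormZ a x : vnorm (a *: x) = cabs a * vnorm x.
Proof.
apply/eqP; rewrite -(@eqrXn2 R 2) ?mulr_ge0 ?vnorm_ge0 ?cabs_ge0//.
rewrite exprMn !vnorm_sqr mulr_sumr; apply/eqP/eq_bigr => i _.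
by rewrite mxE cabsM exprMn.
Qed.

Lemma vnormN x : vnorm (- x) = vnorm x.
Proof.
by rewrite /vnorm; congr Num.sqrt; apply: eq_bigr => i _; rewrite mxE cabsN.
Qed.

Lemma vnorm0 : vnorm (0 : 'cV[C]_n) = 0.
Proof. by rewrite -(scale0r 0) vnormZ cabs_real// mul0r. Qed.

Lemma cinner_self_neq0 v : v != 0 -> cinner v v != 0.
Proof.
move=> /vnorm_gt0 v0; rewrite cinner_self fmorph_eq0.
by rewrite expf_neq0// gt_eqF.
Qed.

Lemma projT_Tv v x : v != 0 -> Tv v (projT v x).
Proof.
move=> v0; rewrite /Tv /= /projT cinnerDl cinnerNl cinnerZl.
by rewrite divfK ?subrr// cinner_self_neq0.
Qed.

Lemma projT_id v x : Tv v x -> projT v x = x.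
Proof. by rewrite /Tv /= /projT => ->; rewrite mul0r scale0r subr0. Qed.

(** Pythagoras for the splitting of [x] along [Tv v] and the line of [v]. Dropping one square or the
    other gives contractivity of [projT] and Cauchy-Schwarz. *)
Lemma vnorm_projT_sqr v x : v != 0 ->
  vnorm x ^+ 2 = vnorm (projT v x) ^+ 2 + (cabs (cinner x v) / vnorm v) ^+ 2.
Proof.
move=> v0; have nv := vnorm_gt0 _ v0.
have -> : cabs (cinner x v) / vnorm v = vnorm ((cinner x v / cinner v v) *: v).
  rewrite vnormZ cabsM cabsV cinner_self cabs_real ?sqr_ge0//.
  by field; rewrite gt_eqF.
rewrite -pythagoras ?subrK//.
by rewrite cinnerZr (projT_Tv _ x v0) mulr0.
Qed.

Lemma vnorm_projT v x : v != 0 -> vnorm (projT v x) <= vnorm x.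
Proof.
move=> v0; rewrite -(@ler_pXn2r R 2) ?nnegrE ?vnorm_ge0//.
by rewrite (vnorm_projT_sqr v x v0) lerDl sqr_ge0.
Qed.

Lemma cauchy_schwarz x v : cabs (cinner x v) <= vnorm x * vnorm v.
Proof.
have [->|v0] := eqVneq v 0.
  by rewrite cabs_cinnerC cinner0l cabs_real// mulr_ge0 ?vnorm_ge0.
rewrite -ler_pdivrMr ?vnorm_gt0// -(@ler_pXn2r R 2) ?nnegrE ?vnorm_ge0//.
  by rewrite (vnorm_projT_sqr v x v0) lerDr sqr_ge0.
by rewrite divr_ge0 ?cabs_ge0 ?vnorm_ge0.
Qed.

(** The square of the norm of [x + y] is [cinner x (x + y) + cinner y (x + y)]; Cauchy-Schwarz
    bounds both terms, and one factor [vnorm (x + y)] cancels. *)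
Lemma vnormD x y : vnorm (x + y) <= vnorm x + vnorm y.
Proof.
have [e|xy0] := eqVneq (vnorm (x + y)) 0.
  by rewrite e addr_ge0 ?vnorm_ge0.
have nxy : 0 < vnorm (x + y) by rewrite lt_def xy0 vnorm_ge0.
rewrite -(ler_pM2r nxy) -expr2 -[leLHS]cabs_real ?sqr_ge0// -cinner_self.
rewrite cinnerDl (le_trans (cabsD _ _))// mulrDl lerD//; exact: cauchy_schwarz.
Qed.

Lemma vnormB x y : vnorm (x - y) <= vnorm x + vnorm y.
Proof. by rewrite -(vnormN y) vnormD. Qed.

Lemma projTD v x y : projT v (x + y) = projT v x + projT v y.
Proof. by rewrite /projT cinnerDl mulrDl scalerDl opprD addrACA. Qed.

Lemma projTZ v a x : projT v (a *: x) = a *: projT v x.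
Proof. by rewrite /projT cinnerZl -mulrA -scalerA scalerBr. Qed.

Lemma projTB v x y : projT v (x - y) = projT v x - projT v y.
Proof. by rewrite -[- y]scaleN1r projTD projTZ scaleN1r. Qed.

Lemma vnorm_mulmx (A : 'M[C]_n) x : vnorm (A *m x) <= frob A * vnorm x.
Proof.
rewrite -(@ler_pXn2r R 2) ?nnegrE ?mulr_ge0 ?vnorm_ge0 ?sqrtr_ge0//.
rewrite exprMn vnorm_sqr sqr_sqrtr; last first.
  by apply: sumr_ge0 => i _; apply: sumr_ge0 => j _; exact: sqr_ge0.
rewrite mulr_suml; apply: ler_sum => i _.
(* The [i]-th entry of [A *m x] is the inner product of [x] with the conjugated [i]-th row, so
   Cauchy-Schwarz applies row by row. *)
pose w : 'cV[C]_n := \col_j conjc (A i j).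
have -> : (A *m x) i 0 = cinner x w.
  by rewrite mxE; apply: eq_bigr => j _; rewrite mxE conjcK mulrC.
have -> : \sum_j cabs (A i j) ^+ 2 = vnorm w ^+ 2.
  by rewrite vnorm_sqr; apply: eq_bigr => j _; rewrite mxE cabs_conjc.
rewrite -exprMn ler_pXn2r ?nnegrE ?mulr_ge0 ?vnorm_ge0 ?cabs_ge0//.
by rewrite mulrC cauchy_schwarz.
Qed.

(** * The angle between two lines and the corresponding projections *)

Lemma dPC v w : dP v w = dP w v.
Proof. by rewrite /dP cabs_cinnerC (mulrC (vnorm v)). Qed.

Lemma cos_dP v w : v != 0 -> w != 0 ->
  0 <= dP v w <= pi /\ cos (dP v w) = cabs (cinner v w) / (vnorm v * vnorm w).
Proof.
move=> /vnorm_gt0 v0 /vnorm_gt0 w0.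
apply: acos_def.
rewrite ler_pdivrMr ?mulr_gt0// mul1r cauchy_schwarz andbT.
by rewrite (le_trans (lerN10 _))// divr_ge0 ?cabs_ge0 ?mulr_ge0 ?vnorm_ge0.
Qed.

(** The component of [v] along [w] has length [cos (dP v w) * vnorm v], so by Pythagoras the
    projection has length exactly [sin (dP v w) * vnorm v]. *)
Lemma vnorm_projT_le_dP v w : v != 0 -> w != 0 ->
  vnorm (projT w v) <= dP v w * vnorm v.
Proof.
move=> v0 w0; have [/andP[d0 dpi] cd] := cos_dP v w v0 w0.
have nv := vnorm_gt0 v v0; have nw := vnorm_gt0 w w0.
have e : vnorm (projT w v) ^+ 2 = (sin (dP v w) * vnorm v) ^+ 2.
  rewrite exprMn sin2cos2 cd -[LHS](addrK ((cabs (cinner v w) / vnorm w) ^+ 2)).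
  by rewrite -vnorm_projT_sqr//; field; rewrite !gt_eqF.
have s0 : 0 <= sin (dP v w) by rewrite sin_ge0_pi// d0.
rewrite -(@ler_pXn2r R 2) ?nnegrE ?mulr_ge0 ?vnorm_ge0// e.
by rewrite ler_pXn2r ?nnegrE ?mulr_ge0 ?vnorm_ge0// ler_pM2r// sin_le_id.
Qed.

(** A vector [x] orthogonal to [w] pairs only with the part [projT w v] of [v], which is short when
    the lines are close. *)
Lemma cabs_cinner_Tv_le_dP v w x : v != 0 -> w != 0 -> Tv w x ->
  cabs (cinner x v) <= dP v w * vnorm x * vnorm v.
Proof.
move=> v0 w0 xw.
have -> : cinner x v = cinner x (projT w v).
  rewrite /projT cinnerDr.
  by rewrite -scaleNr cinnerZr xw mulr0 addr0.
rewrite (le_trans (cauchy_schwarz _ _))// mulrAC mulrC.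
by rewrite ler_wpM2r ?vnorm_ge0// vnorm_projT_le_dP.
Qed.

Lemma vnorm_sub_projT_eq v x : v != 0 ->
  vnorm (x - projT v x) = cabs (cinner x v) / vnorm v.
Proof.
move=> v0; rewrite /projT subKr vnormZ cabsM cabsV cinner_self.
by rewrite cabs_real ?sqr_ge0//; field; rewrite gt_eqF ?vnorm_gt0.
Qed.

Lemma vnorm_sub_projT v x : v != 0 -> vnorm (x - projT v x) <= vnorm x.
Proof.
move=> v0; rewrite vnorm_sub_projT_eq//.
by rewrite ler_pdivrMr ?vnorm_gt0// cauchy_schwarz.
Qed.

Lemma vnorm_sub_projT_Tv v w x : v != 0 -> w != 0 -> Tv w x ->
  vnorm (x - projT v x) <= dP v w * vnorm x.
Proof.
move=> v0 w0 xw; rewrite vnorm_sub_projT_eq//.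
by rewrite ler_pdivrMr ?vnorm_gt0// cabs_cinner_Tv_le_dP.
Qed.

(* [projT w - projT v] acts on the line of [v] as [projT w] and on [Tv v] as
   [projT w - 1]; each piece has norm at most the sine of the angle. *)
Lemma vnorm_projT_diff v w x : v != 0 -> w != 0 ->
  vnorm (projT w x - projT v x) <= 2 * dP v w * vnorm x.
Proof.
move=> v0 w0; set y := projT v x.
have -> : projT w x - y = projT w (x - y) - (y - projT w y).
  have E (a b c : 'cV[C]_n) : a - c = a - b - (c - b).
    by rewrite opprB addrA subrK.
  by rewrite projTB; exact: E.
have d0 : 0 <= dP v w by have [/andP[]] := cos_dP v w v0 w0.
have le1 : vnorm (projT w (x - y)) <= dP v w * vnorm x.
  rewrite {1}/y [projT v x]/projT subKr projTZ vnormZ.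
  apply: (@le_trans _ _ (dP v w * vnorm (x - y))); last first.
    by rewrite ler_wpM2l// vnorm_sub_projT.
  rewrite /y [projT v x]/projT subKr vnormZ mulrCA ler_wpM2l ?cabs_ge0//.
  exact: vnorm_projT_le_dP.
have le2 : vnorm (y - projT w y) <= dP v w * vnorm x.
  apply: (@le_trans _ _ (dP w v * vnorm y)).
    by apply: vnorm_sub_projT_Tv => //; exact: projT_Tv.
  by rewrite dPC ler_wpM2l// vnorm_projT.
by rewrite (le_trans (vnormB _ _))//; lra.
Qed.
End HermitianSpace.

(** * Invertibility on [Tv v] and the condition number as a least bound *)

Section ConditionNumber.
Context {R : realType} {n : nat}.
Local Notation C := R[i].
Implicit Types (A : 'M[C]_n) (l : C) (x y v : 'cV[C]_n) (m : R).

Lemma AlvB A l v x y : Alv A l v (x - y) = Alv A l v x - Alv A l v y.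
Proof. by rewrite /Alv mulmxBr projTB. Qed.

Lemma AlvZ A l v (a : C) x : Alv A l v (a *: x) = a *: Alv A l v x.
Proof. by rewrite /Alv -scalemxAr projTZ. Qed.

Lemma Alv0 A l v : Alv A l v 0 = 0.
Proof. by rewrite -{1}(scale0r 0) AlvZ scale0r. Qed.

Lemma Tv0 v : Tv v 0.
Proof. by rewrite /Tv /= cinner0l. Qed.

Lemma TvB v x y : Tv v x -> Tv v y -> Tv v (x - y).
Proof. by rewrite /Tv /= cinnerDl cinnerNl => -> ->; rewrite subrr. Qed.

Lemma TvZ v (a : C) x : Tv v x -> Tv v (a *: x).
Proof. by rewrite /Tv /= cinnerZl => ->; rewrite mulr0. Qed.

Lemma ker0_unitmx (B : 'M[C]_n) :
  (forall x, B *m x = 0 -> x = 0) -> B \in unitmx.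
Proof.
(* [det0P] provides a row vector in the left kernel, hence the passage to the transpose. *)
move=> B0; rewrite -unitmx_tr unitmxE unitfE; apply/det0P => -[u u0 uB].
move/negP: u0; apply; rewrite -[u]trmxK (B0 u^T) ?trmx0//.
by apply: trmx_inj; rewrite trmx_mul trmxK uB trmx0.
Qed.

(* The matrix of [A_{l,v}] on [Tv v], extended by a scalar on the line of [v],
   turns the question into one about square matrices. *)
Lemma ker0_Alv_invertible A l v : v != 0 ->
  (forall x, Tv v x -> Alv A l v x = 0 -> x = 0) -> Alv_invertible A l v.
Proof.
move=> v0 ker0; split=> [x y xv yv|y yv].
  move/eqP; rewrite -subr_eq0 -AlvB => /eqP/ker0 h.
  by apply/eqP; rewrite -subr_eq0 h//; exact: TvB.
pose vs : 'rV[C]_n := \row_j conjc (v j 0).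
have vsE x : v *m (vs *m x) = cinner x v *: v.
  apply/colP => i; rewrite !mxE big_ord1 mulrC !mxE; congr (_ * _).
  by apply: eq_bigr => j _; rewrite !mxE mulrC.
pose P : 'M[C]_n := 1%:M - (cinner v v)^-1 *: (v *m vs).
have PE x : P *m x = projT v x.
  rewrite mulmxBl mul1mx -scalemxAl -mulmxA vsE scalerA.
  by rewrite /projT mulrC.
pose B := P *m (A - l%:M) *m P + v *m vs.
have BE x : B *m x = Alv A l v (projT v x) + cinner x v *: v.
  by rewrite mulmxDl -!mulmxA vsE !PE.
have vnz := cinner_self_neq0 v v0.
(* Only the term [cinner x v *: v] of [B *m x] leaves [Tv v]. This confines to [Tv v] both the
   kernel of [B] and the preimage of a [y] in [Tv v], where [B] agrees with [Alv A l v]. *)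
have BT x : Tv v (B *m x) -> Tv v x.
  rewrite BE /Tv /= cinnerDl (projT_Tv _ _ v0) add0r cinnerZl.
  by move/eqP; rewrite mulf_eq0 (negPf vnz) orbF => /eqP.
have Bu : B \in unitmx.
  apply: ker0_unitmx => x Bx0.
  have xv : Tv v x by apply: BT; rewrite Bx0; exact: Tv0.
  by apply: ker0 => //; rewrite -Bx0 BE projT_id// xv scale0r addr0.
have Ey : B *m (invmx B *m y) = y by rewrite mulKVmx.
have xv : Tv v (invmx B *m y) by apply: BT; rewrite Ey.
exists (invmx B *m y) => //.
by rewrite -[RHS]Ey BE xv scale0r addr0 projT_id.
Qed.

Lemma mu_ge0 A l v : (0 <= mu A l v)%E.
Proof.
rewrite /mu; case: ifP => // _; apply: mule_ge0.
  by rewrite lee_fin sqrtr_ge0.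
apply: ereal_sup_ubound; exists 0; last by rewrite vnorm0.
split; first exact: Tv0.
exists 0; split; [exact: Tv0|by rewrite vnorm0 ler01|].
exact: Alv0.
Qed.

(** From left to right, a finite [mu] gives invertibility, and [x] is rescaled so that its image is
    a unit vector. From right to left, the bound makes the kernel trivial, hence the map invertible,
    which excludes the value [+oo]. *)
Lemma mu_leP A l v m : frob A = 1 -> v != 0 -> 0 <= m ->
  (mu A l v <= m%:E)%E <->
  (forall x, Tv v x -> vnorm x <= m * vnorm (Alv A l v x)).
Proof.
move=> A1 v0 m0; rewrite /mu A1 mul1e; split.
  case: asboolP => // -[inj _] mum x xv.
  have [e|ne] := eqVneq (Alv A l v x) 0.
    have -> : x = 0.
      by apply: inj => //; [exact: Tv0|rewrite e Alv0].
    by rewrite vnorm0 mulr_ge0 ?vnorm_ge0.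
  have ngt := vnorm_gt0 _ ne.
  set a : C := (((vnorm (Alv A l v x))^-1)%:C)%C.
  have ca : cabs a = (vnorm (Alv A l v x))^-1.
    by rewrite cabs_real// invr_ge0 ltW.
  suff : vnorm (a *: x) <= m.
    by rewrite vnormZ ca mulrC ler_pdivrMr.
  rewrite -lee_fin; apply: le_trans mum; apply: ereal_sup_ubound.
  exists (a *: x) => //; split; first exact: TvZ.
  exists (Alv A l v (a *: x)); split=> //.
    by apply: projT_Tv.
  by rewrite AlvZ vnormZ ca mulVf// gt_eqF.
move=> bnd; have inv : Alv_invertible A l v.
  apply: ker0_Alv_invertible => // x xv e.
  apply: vnorm_eq0; apply/eqP; rewrite eq_le vnorm_ge0 andbT.
  by rewrite (le_trans (bnd x xv))// e vnorm0 mulr0.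
case: asboolP => // _; apply: ge_ereal_sup => _ [x [xv [y [yv y1 xy]]] <-].
rewrite lee_fin (le_trans (bnd x xv))// xy.
by rewrite ler_piMr.
Qed.
End ConditionNumber.

(** * Variation of [Alv] with the triple, and bounds on [mu] *)

Section Perturbation.
Context {R : realType} {n : nat}.
Local Notation C := R[i].
Implicit Types (A B : 'M[C]_n) (l k : C) (x y z v w : 'cV[C]_n).

Lemma vnorm_mulmx_sub_scalar A l z :
  vnorm ((A - l%:M) *m z) <= (frob A + cabs l) * vnorm z.
Proof.
rewrite mulmxBl mul_scalar_mx (le_trans (vnormB _ _))// mulrDl vnormZ lerD2r.
exact: vnorm_mulmx.
Qed.

Lemma cabs_eigenvalue_le_frob A l v : v != 0 -> A *m v = l *: v ->
  cabs l <= frob A.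
Proof.
by move=> v0 Av; rewrite -(ler_pM2r (vnorm_gt0 v v0)) -vnormZ -Av vnorm_mulmx.
Qed.

Lemma vnorm_Alv_le A l v z : v != 0 ->
  vnorm (Alv A l v z) <= (frob A + cabs l) * vnorm z.
Proof.
by move=> v0; rewrite (le_trans (vnorm_projT _ _ _))// vnorm_mulmx_sub_scalar.
Qed.

(** The change is made in two steps: the projection changes while the vector [(A - l) z] is kept,
    then matrix and scalar change under the fixed contraction [projT w]. *)
Lemma vnorm_Alv_diff A l v B k w z : v != 0 -> w != 0 ->
  vnorm (Alv B k w z - Alv A l v z) <=
  (frob (A - B) + cabs (l - k) + 2 * dP v w * (frob A + cabs l)) * vnorm z.
Proof.
move=> v0 w0; set Mz := (A - l%:M) *m z.
have d0 : 0 <= dP v w by have [/andP[]] := cos_dP v w v0 w0.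
have -> : Alv B k w z - Alv A l v z =
    (projT w Mz - projT v Mz) - projT w ((A - B - (l - k)%:M) *m z).
  rewrite /Alv -/Mz [in RHS]addrAC -projTB; congr (projT w _ - _).
  rewrite -mulmxBl; congr (_ *m _).
  by apply/matrixP => i j; rewrite !mxE mulrnBl; ring.
rewrite (le_trans (vnormB _ _))// mulrDl addrC lerD//.
  by rewrite (le_trans (vnorm_projT _ _ _))// vnorm_mulmx_sub_scalar.
rewrite (le_trans (vnorm_projT_diff _ _ _ v0 w0))//.
by rewrite -[leRHS]mulrA ler_wpM2l ?mulr_ge0// vnorm_mulmx_sub_scalar.
Qed.

Lemma vnorm_le_projT_dP v w x : v != 0 -> w != 0 -> Tv w x ->
  vnorm x <= vnorm (projT v x) + dP v w * vnorm x.
Proof.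
move=> v0 w0 xw; have h := vnorm_sub_projT_Tv v w x v0 w0 xw.
rewrite -{1}(subrK (projT v x) x) addrC (le_trans (vnormD _ _))//.
by rewrite lerD2l.
Qed.

Lemma Alv_projT_eigen A l v x : A *m v = l *: v ->
  Alv A l v (projT v x) = Alv A l v x.
Proof.
move=> Av; rewrite /Alv {2}/projT mulmxBr -scalemxAr.
by rewrite [_ *m v]mulmxBl Av mul_scalar_mx subrr scaler0 subr0.
Qed.

(** If [Tv v] is zero, every vector is a multiple of [v], and two multiples of [v] are orthogonal
    only if one of them vanishes. *)
Lemma Tv_trivial v w : v != 0 -> w != 0 ->
  (forall x, Tv v x -> x = 0) -> forall x, Tv w x -> x = 0.
Proof.
move=> v0 w0 triv x.
have line y : exists c, y = c *: v.
  exists (cinner y v / cinner v v); apply/eqP; rewrite -subr_eq0; apply/eqP.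
  exact/triv/(projT_Tv v y v0).
have [a xE] := line x; have [b wE] := line w.
rewrite xE wE /Tv /= cinnerZl cinnerZr => /eqP.
have b0 : b != 0 by apply: contraNneq w0 => b0; rewrite wE b0 scale0r.
rewrite !mulf_eq0 (negPf (cinner_self_neq0 v v0)) conjc_eq0 (negPf b0) !orbF.
by move=> /eqP ->; rewrite scale0r.
Qed.

Lemma mu_trivial A l v : frob A = 1 -> v != 0 -> (forall x, Tv v x -> x = 0) ->
  mu A l v = 0%E.
Proof.
move=> A1 v0 triv; apply/eqP; rewrite eq_le mu_ge0 andbT.
by apply/mu_leP => // x /triv ->; rewrite vnorm0 mul0r.
Qed.

(** An eigenvalue satisfies [cabs l <= frob A = 1], so [Alv A l v] has norm at most 2 and its
    inverse has norm at least 1/2. The nonzero [x] ensures that [Tv v] is not trivial. *)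
Lemma mu_lb A l v (m : R) x : frob A = 1 -> v != 0 -> A *m v = l *: v ->
  Tv v x -> x != 0 -> (mu A l v = m%:E)%E -> 1 / 2 <= m.
Proof.
move=> A1 v0 Av xv x0 mE; have m0 : 0 <= m by rewrite -lee_fin -mE mu_ge0.
have nx := vnorm_gt0 x x0.
have : (mu A l v <= m%:E)%E by rewrite mE.
move/(mu_leP A l v m A1 v0 m0)/(_ x xv) => h.
have l1 : cabs l <= 1 by rewrite -A1 (cabs_eigenvalue_le_frob _ _ _ v0 Av).
have h2 : vnorm (Alv A l v x) <= 2 * vnorm x.
  rewrite (le_trans (vnorm_Alv_le _ _ _ _ v0))// ler_wpM2r ?vnorm_ge0//.
  by rewrite A1; lra.
rewrite -(ler_pM2r nx); have := ler_wpM2l m0 h2; lra.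
Qed.

Lemma dist3_ge A l v B k w : frob A = 1 -> frob B = 1 -> v != 0 -> w != 0 ->
  [/\ 0 <= dist3 A l v B k w, frob (A - B) <= dist3 A l v B k w,
      cabs (l - k) <= dist3 A l v B k w & dP v w <= dist3 A l v B k w].
Proof.
move=> A1 B1 v0 w0; have [/andP[d0 _] _] := cos_dP v w v0 w0.
rewrite /dist3 A1 B1 invr1 !scale1r !mulr1.
have le_sqrt (a s : R) : 0 <= a -> a ^+ 2 <= s -> a <= Num.sqrt s.
  by move=> a0 h; rewrite -[leLHS]ger0_norm// -sqrtr_sqr ler_wsqrtr.
have q1 := sqr_ge0 (frob (A - B)); have q2 := sqr_ge0 (cabs (l - k)).
have q3 := sqr_ge0 (dP v w).
split; first exact: sqrtr_ge0.
- by apply: le_sqrt; [exact: sqrtr_ge0|lra].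
- by apply: le_sqrt; [exact: cabs_ge0|lra].
- by apply: le_sqrt => //; lra.
Qed.

(** * Comparison of the two restricted maps in terms of the distance *)

Section TwoTriples.
Context {A B : 'M[C]_n} {v w : 'cV[C]_n} {l k : C}.
Hypotheses (A1 : frob A = 1) (B1 : frob B = 1) (v0 : v != 0) (w0 : w != 0).
Hypothesis Av : A *m v = l *: v.
Let d := dist3 A l v B k w.

Let l1 : cabs l <= 1.
Proof. by rewrite -A1 (cabs_eigenvalue_le_frob _ _ _ v0 Av). Qed.

(** The constant is 6 = 1 + 1 + 2 * (1 + 1): matrix, eigenvalue, and twice the angle times
    [frob A + cabs l <= 2]. *)
Lemma vnorm_Alv_diff_dist3 z :
  vnorm (Alv B k w z - Alv A l v z) <= 6 * d * vnorm z.
Proof.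
rewrite (le_trans (vnorm_Alv_diff A l v B k w z v0 w0))//.
rewrite ler_wpM2r ?vnorm_ge0// A1.
have [/andP[d0 _] _] := cos_dP v w v0 w0.
have [_ d1 d2 d3] := dist3_ge A l v B k w A1 B1 v0 w0.
have := mulr_ge0 d0 (cabs_ge0 l).
have : dP v w * cabs l <= dP v w by rewrite ler_piMr.
rewrite -/d in d1 d2 d3 *; lra.
Qed.

Lemma Alv_transport_to_eigen x : Tv w x ->
  vnorm x <= vnorm (projT v x) + d * vnorm x /\
  vnorm (Alv A l v (projT v x)) <= vnorm (Alv B k w x) + 6 * d * vnorm x.
Proof.
move=> xw; have [_ _ _ d3] := dist3_ge A l v B k w A1 B1 v0 w0.
split.
  rewrite (le_trans (vnorm_le_projT_dP v w x v0 w0 xw))// lerD2l.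
  by rewrite ler_wpM2r ?vnorm_ge0.
rewrite Alv_projT_eigen// -[X in vnorm X](subKr (Alv B k w x)).
by rewrite (le_trans (vnormB _ _))// lerD2l vnorm_Alv_diff_dist3.
Qed.

(** The constant [8 + d] is 6 for the change of map plus [2 + d], which bounds [frob B + cabs k] and
    so the effect of [B - k] on [x - projT w x]. *)
Lemma Alv_transport_from_eigen x : Tv v x ->
  vnorm x <= vnorm (projT w x) + d * vnorm x /\
  vnorm (Alv B k w (projT w x)) <=
    vnorm (Alv A l v x) + (8 + d) * d * vnorm x.
Proof.
move=> xv; have [dge d1 d2 d3] := dist3_ge A l v B k w A1 B1 v0 w0.
rewrite -/d in dge d1 d2 d3.
split.
  rewrite (le_trans (vnorm_le_projT_dP w v x w0 v0 xv))// lerD2l.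
  by rewrite dPC ler_wpM2r ?vnorm_ge0.
have k1 : cabs k <= 1 + d.
  have -> : k = l - (l - k) by rewrite subKr.
  by rewrite (le_trans (cabsD _ _))// cabsN lerD.
have e1 : vnorm (Alv B k w (x - projT w x)) <= (2 + d) * (d * vnorm x).
  rewrite (le_trans (vnorm_Alv_le _ _ _ _ w0))//.
  rewrite ler_pM ?vnorm_ge0 ?addr_ge0 ?cabs_ge0 ?sqrtr_ge0//.
    by rewrite B1; lra.
  rewrite (le_trans (vnorm_sub_projT_Tv w v x w0 v0 xv))//.
  by rewrite dPC ler_wpM2r ?vnorm_ge0.
have e2 := vnorm_Alv_diff_dist3 x.
have -> : Alv B k w (projT w x) =
    Alv A l v x + (Alv B k w x - Alv A l v x) - Alv B k w (x - projT w x).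
  have E (a b c : 'cV[C]_n) : c = a + (b - a) - (b - c).
    by rewrite (addrC a) subrK subKr.
  by rewrite AlvB; exact: E.
rewrite (le_trans (vnormB _ _))//.
have := vnormD (Alv A l v x) (Alv B k w x - Alv A l v x).
lra.
Qed.
End TwoTriples.
End Perturbation.

(** * The two inequalities between the condition numbers *)

Theorem theorem2p9 (R : realType) (n : nat)
    (A A' : 'M[R[i]]_n) (v v' : 'cV[R[i]]_n) (l l' : R[i]) (eps : R) :
  frob A = 1 -> frob A' = 1 ->
  v != 0 -> v' != 0 ->
  A *m v = l *: v ->
  0 < eps -> eps < 37 / 100 ->
  (mu A l v * (dist3 A l v A' l' v')%:E <= (eps / (25 / 2))%:E)%E ->
  (((1 + eps)^-1)%:E * mu A l v <= mu A' l' v'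
   <= (1 + eps)%:E * mu A l v)%E.
Proof.
move=> A1 A1' v0 v0' Av e0 e1 hmu.
(* When [Tv v] is zero, the bound [mu >= 1/2] fails, but both condition numbers are 0. *)
have [triv|ntriv] := pselect (forall x, Tv v x -> x = 0).
  rewrite (mu_trivial A l v)// (mu_trivial A' l' v')//; last first.
    exact: Tv_trivial triv.
  by rewrite !mule0 lexx.
have [x0 x0v x00] : exists2 x, Tv v x & x != 0.
  apply: contrapT => h; apply: ntriv => x xv; apply: contrapT => /eqP x0.
  by apply: h; exists x.
have [d0 _ _ _] := dist3_ge A l v A' l' v' A1 A1' v0 v0'.
have up := @Alv_transport_to_eigen _ _ _ _ _ _ _ l' A1 A1' v0 v0' Av.
have down := @Alv_transport_from_eigen _ _ _ _ _ _ _ l' A1 A1' v0 v0' Av.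
set d := dist3 A l v A' l' v' in hmu d0 up down.
have ep : 0 < 1 + eps by lra.
(* The second claim concerns finite [m] below [mu], since [mu] may be [+oo]. In that case the
   hypothesis forces [d = 0], which it allows because [+oo * 0 = 0]. *)
have [dsmall mdsmall] : d <= 2 * eps / (25 / 2) /\
    forall m : R, 0 <= m -> (m%:E <= mu A l v)%E -> m * d <= eps / (25 / 2).
  move: hmu; case mE : (mu A l v) => [r| |].
  - rewrite -EFinM lee_fin => rd; have r2 := mu_lb A l v r x0 A1 v0 Av x0v x00 mE.
    split; first by have := ler_wpM2r d0 r2; lra.
    by move=> m m0; rewrite lee_fin => mr; have := ler_wpM2r d0 mr; lra.
  - have [->|dn0] := eqVneq d 0.
      by move=> _; split=> [|m _ _]; rewrite ?mulr0; lra.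
    by rewrite gt0_mulye// lte_fin lt_def dn0.
  - by have := mu_ge0 A l v; rewrite mE.
apply/andP; split.
- rewrite lee_pdivrMl//.
  have := mu_ge0 A' l' v'; case m'E : (mu A' l' v') => [m'| |] // m'0; last first.
    by rewrite gt0_muley ?lte_fin// leey.
  (* Arguing by contradiction places [(1 + eps) * m'] below [mu A l v], so that [mdsmall] bounds its
     product with [d] even if [mu A l v] is infinite. *)
  rewrite lee_fin in m'0; rewrite -EFinM leNgt; apply/negP => lt_m.
  have bnd' : (mu A' l' v' <= m'%:E)%E by rewrite m'E.
  move/(mu_leP _ _ _ _ A1' v0' m'0) in bnd'.
  have M0 : 0 <= (1 + eps) * m' by rewrite mulr_ge0// ltW.
  have Md := mdsmall _ M0 (ltW lt_m).
  suff : (mu A l v <= ((1 + eps) * m')%:E)%E by rewrite leNgt lt_m.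
  apply/mu_leP => // x xv; have [h1 h2] := down x xv.
  have h3 := bnd' _ (projT_Tv v' x v0').
  set X := vnorm x in h1 h2 *; set a := vnorm (Alv A l v x) in h2 *.
  have X0 : 0 <= X := vnorm_ge0 x.
  have h4 := ler_wpM2l M0 h2.
  have h5 : (1 + eps) * (X - d * X) <= (1 + eps) * m' * a +
      (8 + d) * X * ((1 + eps) * m' * d).
    have := ler_wpM2l (ltW ep) h3.
    have := ler_wpM2l (ltW ep) h1; lra.
  have h6 : (8 + d) * X * ((1 + eps) * m' * d) <= (8 + d) * X * (eps / (25 / 2)).
    by rewrite ler_wpM2l// mulr_ge0// addr_ge0.
  (* With [d <= 0.16 * eps] the bracket is at least [eps * (0.2 - 0.1728 * eps)], which is positive
     here. *)
  have h7 : 0 <= (eps - d * (1 + eps) - (8 + d) * (eps / (25 / 2))) * X.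
    rewrite mulr_ge0//; nra.
  lra.
- case mE : (mu A l v) => [m| |]; last first.
  + by have := mu_ge0 A l v; rewrite mE.
  + by rewrite gt0_muley ?lte_fin// leey.
  have m0 : 0 <= m by rewrite -lee_fin -mE mu_ge0.
  have bnd : (mu A l v <= m%:E)%E by rewrite mE.
  move/(mu_leP _ _ _ _ A1 v0 m0) in bnd.
  have md : m * d <= eps / (25 / 2) by apply: mdsmall; rewrite ?mE.
  rewrite -EFinM; apply/mu_leP => //; first by rewrite mulr_ge0// ltW.
  move=> x xw; have [h1 h2] := up x xw.
  have h3 := bnd _ (projT_Tv v x v0).
  set X := vnorm x in h1 h2 *; set b := vnorm (Alv A' l' v' x) in h2 *.
  have X0 : 0 <= X := vnorm_ge0 x.
  have h4 := ler_wpM2l m0 h2.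
  have h5 : X * (1 - d - 6 * (m * d)) <= m * b by lra.
  have h6 := ler_wpM2l (ltW ep) h5.
  (* Here [d + 6 * (m * d) <= 0.16 * eps + 0.48 * eps = 0.64 * eps], so the second factor is at
     least [eps * (0.36 - 0.64 * eps)], positive for [eps < 0.37]. *)
  have h7 : 0 <= X * ((1 + eps) * (1 - d - 6 * (m * d)) - 1).
    by rewrite mulr_ge0//; nra.
  lra.
Qed.
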